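(* Let $\phi>0$. There are no $(\phi,\alpha)$-expanders for $\alpha>\tfrac{1}{1+\phi}$.
   Context: Graphs are finite, simple, undirected and unweighted. For $S\subseteq V$ let $N(S)=\{v\in V:\exists s\in S,\ \{s,v\}\in E\}$ and $\partial S=N(S)\setminus S$. For $\phi\in(0,n)$ and $\alpha\in(0,\tfrac12]$, a graph $G=(V,E)$ with $n$ nodes is a $(\phi,\alpha)$-expander (small-set vertex expander) if $|\partial S|\ge \phi|S|$ for every $S\subseteq V$ with $0<|S|\le\alpha n$.
   Formalization: As stated the claim fails by rounding (K_3 is a (2,2/5)-expander though 2/5 > 1/3); what is proved is that no such expander exists when αn is an integer, and, for fixed φ and α, none exists on sufficiently many nodes. *)

(* Defs.v *)
From mathcomp Require Import all_boot all_order all_algebra.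
From mathcomp Require Import reals.
Set Implicit Arguments.
Unset Strict Implicit.
Unset Printing Implicit Defensive.
Import Order.TTheory GRing.Theory Num.Theory.
Local Open Scope ring_scope.

Record sgraph := SGraph {
  vertex :> finType;
  adj : rel vertex;
  adj_sym : symmetric adj;
  adj_irr : irreflexive adj }.

Definition nbhd (G : sgraph) (S : {set G}) : {set G} :=
  [set v | [exists s in S, adj s v]].

Definition vboundary (G : sgraph) (S : {set G}) : {set G} := nbhd S :\: S.

(* The parameter domain phi in (0, n), alpha in (0, 1/2] is part of the
   notion: outside it, nothing is a (phi, alpha)-expander. *)
Definition expander (R : realType) (phi alpha : R) (G : sgraph) : Prop :=
  [/\ 0 < phi < #|G|%:R,
      0 < alpha <= 1 / 2
    & forall S : {set G}, (0 < #|S|)%N -> #|S|%:R <= alpha * #|G|%:R ->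
        phi * #|S|%:R <= #|vboundary S|%:R].

(* Main.v *)
(* A set S with |S| = k <= alpha n has at most n - k boundary vertices, so
   expansion gives (1 + phi) k <= n.  Taking k = alpha n when this is an
   integer, or its floor when n is large, contradicts alpha (1 + phi) > 1. *)
Require Import Defs.
From mathcomp Require Import all_boot all_order all_algebra.
From mathcomp Require Import reals.
From mathcomp Require Import lra.
Set Implicit Arguments.
Unset Strict Implicit.
Unset Printing Implicit Defensive.
Import Order.TTheory GRing.Theory Num.Theory.
Local Open Scope ring_scope.

Lemma exists_set_card (T : finType) (k : nat) :
  (k <= #|T|)%N -> exists S : {set T}, #|S| = k.
Proof.
move=> le_kT; exists [set x in take k (enum T)].
rewrite cardsE (card_uniqP _) ?take_uniq ?enum_uniq //.
by rewrite size_take_min -cardE; apply/minn_idPl.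
Qed.

(** [vboundary S] removes [S], so it lies in the complement of [S]. *)
Lemma card_vboundary_le (G : sgraph) (S : {set G}) :
  (#|S| + #|vboundary S| <= #|G|)%N.
Proof.
rewrite -(cardsC S) leq_add2l; apply: subset_leq_card.
by rewrite /vboundary setDE subsetIr.
Qed.

Lemma expander_card_ge (R : realType) (phi alpha : R) (G : sgraph) (k : nat) :
  expander phi alpha G -> (0 < k)%N -> k%:R <= alpha * #|G|%:R ->
  (1 + phi) * k%:R <= #|G|%:R.
Proof.
move=> [_ /andP[_ alpha_le] expG] k_gt0 k_le.
have n_ge0 : 0 <= #|G|%:R :> R by [].
have [|S cardS] := @exists_set_card G k.
  (* Since [alpha <= 1 / 2], [k <= alpha n <= n], so a set of size [k] exists. *)
  by rewrite -(ler_nat R); nra.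
have := expG S; rewrite cardS => /(_ k_gt0 k_le).
have := card_vboundary_le S; rewrite cardS -(ler_nat R) natrD; lra.
Qed.

Theorem lemma4p1 (R : realType) (phi : R) (hphi : 0 < phi)
    (alpha : R) (halpha : 1 / (1 + phi) < alpha) :
  (forall G : sgraph,
     alpha * #|G|%:R \is a Num.nat -> ~ expander phi alpha G) /\
  (exists n0 : nat, forall G : sgraph,
     (n0 <= #|G|)%N -> ~ expander phi alpha G).
Proof.
have phi1_gt0 : 0 < 1 + phi by lra.
have c_gt1 : 1 < alpha * (1 + phi) by rewrite -ltr_pdivrMr.
split=> [G /natrP[k alphaGk] expG|].
  have [/andP[_ phi_lt] /andP[alpha_gt0 _] _] := expG.
  have n_gt0 : 0 < #|G|%:R :> R by apply: lt_trans phi_lt.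
  have k_gt0 : (0 < k)%N by rewrite -(ltr_nat R) -alphaGk mulr_gt0.
  have := expander_card_ge expG k_gt0; rewrite -alphaGk lexx => /(_ isT).
  (* Multiplying [c_gt1] by [n > 0] gives [n < (1 + phi) alpha n], against the bound just
     obtained. *)
  nra.
(* Rounding [alpha n] down costs less than 1, hence less than [1 + phi] after scaling by [1 + phi].
   The surplus of [(1 + phi) alpha n] over [n] is [c n], so [n > (1 + phi) / c] absorbs this
   loss. *)
pose c := alpha * (1 + phi) - 1.
have c_gt0 : 0 < c by rewrite /c; lra.
exists (Num.truncn ((1 + phi) / c)).+1 => G n0_le expG.
have n_gt : 1 + phi < c * #|G|%:R.
  rewrite mulrC -ltr_pdivrMr //; apply: lt_le_trans (truncnS_gt _) _.
  by rewrite ler_nat.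
have n_ge0 : 0 <= #|G|%:R :> R by [].
(* Ensures that the floor of [alpha n] is positive: [(1 + phi) alpha n = n + c n > 1 + phi]. *)
have x_ge1 : 1 <= alpha * #|G|%:R.
  by rewrite -(ler_pM2l phi1_gt0); rewrite /c in n_gt; lra.
have /andP[k_le k_gt] := truncn_itv (le_trans ler01 x_ge1).
have k_gt0 : (0 < Num.truncn (alpha * #|G|%:R))%N by rewrite truncn_gt0.
have := expander_card_ge expG k_gt0 k_le.
move: k_gt; rewrite -natr1 -(ltr_pM2l phi1_gt0) => k_gt.
rewrite /c in n_gt; lra.
Qed.
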